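(* Let $b=3$. There exists no Type 1 triangle with base $3$ repeated digits. In other words, there exists no triangle which is a $T_1(k,3,d)$, for any integers $k\geq 2$ and $d$ with $2\leq d\leq b-1=2$.
   Context: A Pythagorean triangle is a right triangle all of whose side lengths are positive integers. For integers $b\geq 3$, $2\leq d\leq b-1$ and $k\geq 2$, $d_{k,b}=d\,(b^{k-1}+\cdots+b+1)=\dfrac{d(b^k-1)}{b-1}$ denotes the positive integer whose base $b$ representation consists of $k$ digits all equal to $d$. A Pythagorean triangle is a Type 1 triangle with base $b$ repeated digits, denoted $T_1(k,b,d)$ (with $b\geq 3$, $2\leq d\leq b-1$, $k\geq 2$), if one of its two legs has length $d^k$ and its hypotenuse has length $d_{k,b}$. *)

(* Defs.v *)
From mathcomp Require Import all_boot.

Set Implicit Arguments.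
Unset Strict Implicit.
Unset Printing Implicit Defensive.

(* A right triangle with positive integer sides, given by its side lengths;
   the order of the two legs carries no meaning. *)
Record pythagorean_triangle := PythagoreanTriangle {
  leg1 : nat;
  leg2 : nat;
  hypotenuse : nat;
  leg1_gt0 : 0 < leg1;
  leg2_gt0 : 0 < leg2;
  hypotenuse_gt0 : 0 < hypotenuse;
  pythagoras : leg1 ^ 2 + leg2 ^ 2 = hypotenuse ^ 2
}.

(* d_{k,b}: the number with k digits, all equal to d, in base b. *)
Definition repdigit (k b d : nat) : nat := d * \sum_(i < k) b ^ i.

(* T_1(k,b,d): one leg d^k, hypotenuse d_{k,b}. *)
Definition is_type1 (k b d : nat) (T : pythagorean_triangle) : Prop :=
  [/\ 3 <= b, 2 <= d <= b - 1, 2 <= k,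
      leg1 T = d ^ k \/ leg2 T = d ^ k
    & hypotenuse T = repdigit k b d].

(* Main.v *)
Require Import Defs.
From mathcomp Require Import all_boot.

(** Here [d = 2], so the hypotenuse is [h = 3 ^ k - 1], one leg is [2 ^ k], and
    the other leg [y] would satisfy [y ^ 2 = (3 ^ k - 1) ^ 2 - 4 ^ k].  Two
    congruences exclude this for [k >= 2].
    - Modulo 9, [3 ^ k] vanishes and the right-hand side is [1 - 4 ^ k].  Since
      4 has order 3 modulo 9, it is 0, 6 or 3 according to [k %% 3], and only 0
      is a square modulo 9: hence 3 divides [k] ([dvd3_exponent]).
    - For [k = 3 * j], [3 ^ k = 27 ^ j] is [(-1) ^ j] and [4 ^ k = 64 ^ j] is 1
      modulo 7, so the right-hand side is -1 or 3 modulo 7; neither is a square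
      modulo 7 ([exponent_not_mul3]). *)

Lemma repdigit_predn (k b : nat) : repdigit k b b.-1 = (b ^ k).-1.
Proof. by rewrite /repdigit predn_exp. Qed.

Lemma sqr_mod9 (y : nat) : y ^ 2 %% 9 \in [:: 0; 1; 4; 7].
Proof.
rewrite -modnXm; have := ltn_pmod y (isT : 0 < 9).
by move: (y %% 9); do 9?[case=> //].
Qed.

Lemma sqr_mod7 (y : nat) : y ^ 2 %% 7 \in [:: 0; 1; 2; 4].
Proof.
rewrite -modnXm; have := ltn_pmod y (isT : 0 < 7).
by move: (y %% 7); do 7?[case=> //].
Qed.

(** The hypotenuse [h] is given by its successor so that no truncated subtraction
    occurs; [2 <= k] makes [3 ^ k] vanish modulo 9. *)
Lemma dvd3_exponent (k h y : nat) :
  2 <= k -> h.+1 = 3 ^ k -> y ^ 2 + (2 ^ k) ^ 2 = h ^ 2 -> 3 %| k.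
Proof.
move=> k_ge2 h_succ pyth.
have h9 : h %% 9 = 8.
  apply/eqP; rewrite -[8]/(8 %% 9) -(eqn_modDr 1) addn1 h_succ modnn.
  exact: (@dvdn_exp2l 3 2 k).
have pow4 : (2 ^ k) ^ 2 = 4 ^ (k %% 3) %[mod 9].
  rewrite expnAC {1}(divn_eq k 3) expnD [_ %/ 3 * 3]mulnC expnM.
  by rewrite -modnMml -modnXm exp1n mul1n.
have : y ^ 2 %% 9 + 4 ^ (k %% 3) = 1 %[mod 9].
  by rewrite modnDml -modnDmr -pow4 modnDmr pyth -modnXm h9.
rewrite /dvdn; have := sqr_mod9 y; have := ltn_pmod k (isT : 0 < 3).
move: (k %% 3) (y ^ 2 %% 9) => r s.
by rewrite !inE; case: r => [|[|[|]]] // _ /or4P[] /eqP->.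
Qed.

(** Together with [3 | k] this is the contradiction: [2] has order 3 modulo 7 and
    [27 = -1] modulo 7. *)
Lemma exponent_not_mul3 (j h y : nat) :
  h.+1 = 3 ^ (3 * j) -> y ^ 2 + (2 ^ (3 * j)) ^ 2 <> h ^ 2.
Proof.
move=> h_succ pyth.
have pow4 : (2 ^ (3 * j)) ^ 2 = 1 %[mod 7].
  by rewrite expnM expnAC -modnXm exp1n.
(* [h + 1] is [(-1) ^ j] modulo 7, so [h] is 0 or -2. *)
have h7 : h %% 7 \in [:: 0; 5].
  have : h.+1 = 6 ^ odd j %[mod 7].
    rewrite h_succ expnM -modnXm -{1}(odd_double_half j) -muln2 expnD.
    by rewrite [_./2 * 2]mulnC expnM -modnMmr -[X in _ * X]modnXm exp1n muln1.
  rewrite -addn1 -modnDml; have := ltn_pmod h (isT : 0 < 7).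
  by case: (odd j); move: (h %% 7); do 7?[case=> //].
have : y ^ 2 %% 7 + 1 = (h %% 7) ^ 2 %[mod 7].
  by rewrite modnDml -modnDmr -pow4 modnDmr pyth modnXm.
have := sqr_mod7 y; move: (y ^ 2 %% 7) h7 => s.
by rewrite !inE => /orP[] /eqP-> /or4P[] /eqP->.
Qed.

Theorem theorem4 (k d : nat) (hk : 2 <= k) (hd : 2 <= d <= 3 - 1) :
  ~ exists T : pythagorean_triangle, is_type1 k 3 d T.
Proof.
have d2 : d = 2 by apply/eqP; rewrite eqn_leq andbC.
case=> T [_ _ _ leg hyp]; rewrite {d hd}d2 in leg hyp.
have h_succ : (hypotenuse T).+1 = 3 ^ k.
  by rewrite hyp (repdigit_predn k 3) prednK // expn_gt0.
have [y pyth] : exists y, y ^ 2 + (2 ^ k) ^ 2 = hypotenuse T ^ 2.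
  case: leg => <-; [exists (leg2 T); rewrite addnC | exists (leg1 T)];
    exact: pythagoras.
have /dvdnP[j k_eq] := dvd3_exponent _ _ _ hk h_succ pyth.
rewrite mulnC in k_eq; rewrite k_eq in h_succ pyth.
exact: exponent_not_mul3 pyth.
Qed.
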